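(* Let $n\ge2$, let $G(V,E)$ be a connected directed graph on $V=\{1,\dots,n\}$ with positive weights $\alpha_{ij}$ ($ij\in E$) whose Laplacian matrix $L$ has real eigenvalues. Let $R=\mathrm{diag}(r_1,\dots,r_n)$ with $r_i>0$, let $\tau>0$ and $\kappa_1,\kappa_2,p\in\mathbb R$, and let $\mu_{\max}$ be the largest eigenvalue of $LR$. Then the system $z_{k+1}=Az_k$ defined in the context achieves synchronization if and only if (i) $|1-p|<1$, or equivalently $2>p>0$; (ii) $\dfrac{2\kappa_1}{3p}>\kappa_1-\kappa_2>0$; and (iii) $\tau<\dfrac{p\,(\kappa_2-p(\kappa_1-\kappa_2))}{\mu_{\max}\,(\kappa_1-p(\kappa_1-\kappa_2))^2}$.
   Context: $G(V,E)$ is a directed graph without self-loops; $ij\in E$ means node $i$ measures its clock offset with respect to $j$, and $\mathcal N_i=\{j:ij\in E\}$. The graph is called connected if there is a node that every other node can reach by a directed path (equivalently, $L$ has $0$ as a simple eigenvalue). The Laplacian $L\in\mathbb R^{n\times n}$ has $L_{ii}=\sum_{j\in\mathcal N_i}\alpha_{ij}$, $L_{ij}=-\alpha_{ij}$ if $ij\in E$, and $L_{ij}=0$ otherwise. The state is $z_k=[x(t_k)^T\,s(t_k)^T\,y(t_k)^T]^T\in\mathbb R^{3n}$, with $t_k=t_0+k\tau$, and $$A=\begin{bmatrix} I_n&\tau R&0\\-\kappa_1L&I_n&-\kappa_2I_n\\-pL&0&(1-p)I_n\end{bmatrix}.$$ The system achieves synchronization if for every initial condition $z_0\in\mathbb R^{3n}$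 there are constants $r^*,x^*\in\mathbb R$ such that $x_i(t_k)-\big(r^*(t_k-t_0)+x^*\big)\to0$ as $k\to\infty$ for every $i\in V$.
   Formalization: The largest eigenvalue μ_max of LR is taken to presuppose that all eigenvalues of LR are real; real eigenvalues of L alone do not ensure this (a weighted directed 3-cycle is a counterexample), and the equivalence fails otherwise. *)

(* Defs.v *)
From HB Require Import structures.
From mathcomp Require Import all_boot all_order all_algebra.
From mathcomp Require Import all_classical all_reals all_analysis.
From mathcomp Require Import complex.

Set Implicit Arguments.
Unset Strict Implicit.
Unset Printing Implicit Defensive.

Import Order.TTheory GRing.Theory Num.Theory.
Import numFieldNormedType.Exports.

Local Open Scope ring_scope.
Local Open Scope complex_scope.
Local Open Scope classical_set_scope.

(* [E i j] means that node i measures its clock offset with respect to j, so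
   edges point from i to j and the distinguished node is reached from all
   others. *)
Definition connected_digraph (n : nat) (E : rel 'I_n) : Prop :=
  exists root : 'I_n, forall i : 'I_n, connect E i root.

Definition laplacian (R : realType) (n : nat) (E : rel 'I_n)
    (alpha : 'I_n -> 'I_n -> R) : 'M[R]_n :=
  \matrix_(i, j)
    if i == j then \sum_(k | E i k) alpha i k
    else if E i j then - alpha i j else 0.

Definition complex_mx (R : realType) (n : nat) (M : 'M[R]_n) : 'M[R[i]]_n :=
  map_mx (real_complex R) M.

Definition has_real_eigenvalues (R : realType) (n : nat) (M : 'M[R]_n) : Prop :=
  forall z : R[i], eigenvalue (complex_mx M) z -> z \is Num.real.

(* In the order of R[i], z <= mu%:C holds only if z is real.  Hence a matrix
   has a largest eigenvalue in this sense only if all its complex eigenvalues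
   are real. *)
Definition is_largest_eigenvalue (R : realType) (n : nat) (M : 'M[R]_n)
    (mu : R) : Prop :=
  eigenvalue (complex_mx M) mu%:C /\
  forall z : R[i], eigenvalue (complex_mx M) z -> z <= mu%:C.

Definition system_matrix (R : realType) (n : nat) (L : 'M[R]_n) (r : 'rV[R]_n)
    (tau kappa1 kappa2 p : R) : 'M[R]_(n + (n + n)) :=
  block_mx
    1%:M                                (row_mx (tau *: diag_mx r) 0)
    (col_mx (- kappa1 *: L) (- p *: L)) (block_mx 1%:M (- kappa2)%:M
                                                  0    (1 - p)%:M).

Definition state (R : realType) (n : nat) (A : 'M[R]_(n + (n + n)))
    (z0 : 'cV[R]_(n + (n + n))) (k : nat) : 'cV[R]_(n + (n + n)) :=
  iter k (mulmx A) z0.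

Definition clocks (R : realType) (n : nat) (z : 'cV[R]_(n + (n + n))) :
    'cV[R]_n :=
  usubmx z.

Definition sample_time (R : realType) (t0 tau : R) (k : nat) : R :=
  t0 + k%:R * tau.

Definition achieves_synchronization (R : realType) (n : nat)
    (A : 'M[R]_(n + (n + n))) (t0 tau : R) : Prop :=
  forall z0 : 'cV[R]_(n + (n + n)), exists rstar xstar : R,
    forall i : 'I_n,
      (fun k : nat => clocks (state A z0 k) i 0
         - (rstar * (sample_time t0 tau k - t0) + xstar)) @ \oo --> (0 : R).

(* Main.v *)
(* Write m = lambda - 1 for an eigenvalue lambda of A.  Eliminating x and y from
   the eigenvector equation leaves L R s = nu s together with the cubic
   m^3 + p m^2 + tau nu kappa1 m + tau nu p (kappa1 - kappa2) = 0, unless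
   m = 0 or m = -p.  Conditions (i)-(iii) are the Jury conditions for this
   cubic at nu = mu_max, and they are monotone in nu.

   Sufficiency: the characteristic polynomial is (X - 1)^d h with all roots of
   h in the open unit disc, so Bezout splits a trajectory into a decaying part
   and a part in the kernel of (A - 1)^d.  By the maximum principle for L that
   kernel is already the kernel of (A - 1)^2, where all clocks follow the same
   affine function.

   Necessity: if L R w = nu w, the vectors (a R w, b w, c w) form an invariant
   subspace.  For nu = mu_max the vector R w is not constant, so
   synchronization forces a to tend to 0, which puts every root of the cubic in
   the disc; the case nu = 0 gives |1 - p| < 1. *)

Require Import Defs.
From HB Require Import structures.
From mathcomp Require Import all_boot all_order all_algebra.
From mathcomp Require Import all_classical all_reals all_analysis.
From mathcomp Require Import complex ring lra.

Import Order.TTheory GRing.Theory Num.Theory.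
Import numFieldNormedType.Exports.

Local Open Scope ring_scope.
Local Open Scope complex_scope.

Set Implicit Arguments.
Unset Strict Implicit.
Unset Printing Implicit Defensive.

Import ComplexField.Normc.

(** * Jury conditions for a real cubic *)

Lemma normc_lt1 (R : rcfType) (x y : R) :
  (normc (x +i* y)%C < 1) = (x ^+ 2 + y ^+ 2 < 1).
Proof.
have s0 : 0 <= x ^+ 2 + y ^+ 2 by rewrite addr_ge0 ?sqr_ge0.
by rewrite /= -[X in _ < X]sqrtr1 ltr_sqrt.
Qed.

(** A real root [l] in (-1, 1) is split off the cubic in X = 1 + m; the remaining quadratic X^2 + u
    X + v has its roots in the disc because v < 1 and 1 + u + v, 1 - u + v > 0. The last hypothesis
    is the Jury determinant: p (a - b) - (a - b)^2 - b is the product of the factors 1 - z z' over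
    pairs of roots in X. *)
Lemma cubic_schur_stable (R : rcfType) (p a b : R) :
  0 < p < 2 -> 0 < b -> 3 * b < 2 * a -> (a - b) ^+ 2 + b < p * (a - b) ->
  forall m : R[i],
    m ^+ 3 + p%:C%C * m ^+ 2 + a%:C%C * m + b%:C%C = 0 ->
    normc (1 + m) < 1.
Proof.
move=> /andP[p0 p2] b0 ab hH.
have B2 : 0 < 4 * p - 4 * a + 3 * b by nra.
(* The cubic expanded in X = 1 + m. It equals b > 0 at 1 and -(8 - 4p + 2a - b) < 0 at -1. *)
pose g : {poly R} := 'X^3 + (p - 3)%:P * 'X^2 + (3 - 2 * p + a)%:P * 'X
                     + (p - 1 - a + b)%:P.
have gE x : g.[x] = x ^+ 3 + (p - 3) * x ^+ 2 + (3 - 2 * p + a) * x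
                     + (p - 1 - a + b).
  by rewrite /g !(hornerE, hornerXn).
have [||l /andP[l1 l2] /rootP gl] := @poly_ivt _ g (-1) 1.
- lra.
- by rewrite !gE; apply/andP; split; nra.
rewrite gE in gl.
have l1' : -1 < l.
  rewrite lt_neqAle l1 andbT; apply/eqP => le.
  by move: gl; rewrite -le => ?; lra.
have l2' : l < 1.
  rewrite lt_neqAle l2 andbT; apply/eqP => le.
  by move: gl; rewrite le => ?; lra.
(* Coefficients of the quotient of [g] by X - l; [c0E] says that the remainder vanishes. *)
pose u := l + p - 3; pose v := 3 - 2 * p + a + l * u.
have c0E : p - 1 - a + b = - (l * v) by rewrite /v /u; lra.
have h1 : 0 < 1 + u + v.
  have : b = (1 - l) * (1 + u + v) by rewrite /v /u in c0E *; lra.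
  move=> bE; rewrite bE pmulr_rgt0 in b0 => //; lra.
have h2 : 0 < 1 - u + v.
  have e : 8 - 4 * p + 2 * a - b = (1 + l) * (1 - u + v).
    by rewrite /v /u in c0E *; lra.
  have : 0 < 8 - 4 * p + 2 * a - b by lra.
  rewrite e pmulr_rgt0 //; lra.
have h3 : v < 1.
  have e : p * (a - b) - (a - b) ^+ 2 - b = (1 - v) * (1 + l * u + l ^+ 2 * v).
    have -> : b = a + 1 - p - l * v by lra.
    have -> : a = v - 3 + 2 * p - l * u by rewrite /v; lra.
    have -> : p = u - l + 3 by rewrite /u; lra.
    ring.
  have e2 : 4 * p - 4 * a + 3 * b =
     2 * (1 - v) * (1 + l) + (1 - l) * (1 - u + v).
    rewrite /v /u in c0E *; lra.
  have e3 : 4 * (1 + l * u + l ^+ 2 * v) = (1 + l) ^+ 2 * (1 + u + v) +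
    (1 - l) * (4 * p - 4 * a + 3 * b).
    by rewrite e2; ring.
  have e4 : 0 < 1 + l * u + l ^+ 2 * v.
    have : 0 < (1 + l) ^+ 2 * (1 + u + v).
      by rewrite mulr_gt0// exprn_gt0//; lra.
    have : 0 < (1 - l) * (4 * p - 4 * a + 3 * b).
      by rewrite mulr_gt0//; lra.
    lra.
  have : 0 < (1 - v) * (1 + l * u + l ^+ 2 * v) by rewrite -e; lra.
  by rewrite pmulr_lgt0// subr_gt0.
move=> [x y] hm.
pose X := 1 + x.
have xE : x = X - 1 by rewrite /X; ring.
have -> : 1 + (x +i* y)%C = (X +i* y)%C.
  by apply/eqP; rewrite eq_complex /= add0r !eqxx.
rewrite normc_lt1.
have fac : ((X - l) +i* y)%C *
    ((X ^+ 2 - y ^+ 2 + u * X + v) +i* (2 * X * y + u * y))%C = 0.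
  rewrite -hm; apply/eqP; rewrite eq_complex /= /v /u xE.
  have -> : b = a + 1 - p - l * (3 - 2 * p + a + l * (l + p - 3)).
    by rewrite /v /u in c0E; lra.
  by apply/andP; split; apply/eqP; ring.
move/eqP: fac; rewrite mulf_eq0 !eq_complex /=.
move=> /orP[/andP[/eqP e1 /eqP ->]|/andP[/eqP e1 /eqP e2]].
  have -> : X = l by lra.
  nra.
(* For a real root, |u| < 2 puts the vertex -u/2 inside (-1, 1), and the quadratic is positive at
   both endpoints. For a non-real root, X = -u/2 and the squared modulus is v. *)
have [y0|y0] := eqVneq y 0.
  rewrite y0 in e1 *.
  have uv : -2 < u /\ u < 2 by split; lra.
  have X1 : X < 1.
    rewrite ltNge; apply/negP => X1; nra.
  have X2 : -1 < X.
    rewrite ltNge; apply/negP => X2; nra.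
  nra.
have Xu : u = - (2 * X).
  have /eqP : y * (2 * X + u) = 0 by rewrite -e2; ring.
  rewrite mulf_eq0 (negbTE y0) /= => /eqP; lra.
by move: e1; rewrite Xu; nra.
Qed.

Lemma cubic_real_root (R : rcfType) (p a b : R) :
  exists m : R, m ^+ 3 + p * m ^+ 2 + a * m + b = 0.
Proof.
pose g : {poly R} := 'X^3 + p%:P * 'X^2 + a%:P * 'X + b%:P.
have gE x : g.[x] = x ^+ 3 + p * x ^+ 2 + a * x + b.
  by rewrite /g !(hornerE, hornerXn).
(* M^3 is M^2 times this sum, so the leading term dominates the others at M and at -M. *)
pose M := 1 + `|p| + `|a| + `|b|.
have p0 := normr_ge0 p; have a0 := normr_ge0 a; have b0 := normr_ge0 b.
have M1 : 1 <= M by rewrite /M; lra.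
have [||m _ /rootP] := @poly_ivt _ g (- M) M; last by rewrite gE => ?; exists m.
- lra.
- have pM : `|p * M ^+ 2| <= `|p| * M ^+ 2.
    by rewrite normrM (ger0_norm (sqr_ge0 M)).
  have aM : `|a * M| <= `|a| * M ^+ 2.
    by rewrite normrM ler_wpM2l// ger0_norm; nra.
  have bM : `|b| <= `|b| * M ^+ 2 by rewrite ler_peMr//; nra.
  have M3 : M ^+ 3 = M ^+ 2 + `|p| * M ^+ 2 + `|a| * M ^+ 2 + `|b| * M ^+ 2.
    by rewrite [M ^+ 3]exprS {1}/M; ring.
  have M2 : 0 <= M ^+ 2 by exact: sqr_ge0.
  move: pM aM; rewrite !ler_norml => /andP[pM1 pM2] /andP[aM1 aM2].
  move: (lexx `|b|); rewrite {1}ler_norml => /andP[bM1 bM2].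
  rewrite !gE sqrrN mulrN (_ : (- M) ^+ 3 = - M ^+ 3); last by ring.
  by apply/andP; split; lra.
Qed.

(** For real roots x1, x2, v = x1 x2 and 1 + u + v = (1 - x1)(1 - x2), 1 - u + v = (1 + x1)(1 + x2).
    For conjugate roots, v is the squared modulus and u^2 < 4 v bounds the other two below by
    squares. *)
Lemma quadratic_schur_stable (R : rcfType) (u v : R) :
  (forall z : R[i], z ^+ 2 + u%:C * z + v%:C = 0 -> normc z < 1) ->
  [/\ v < 1, 0 < 1 + u + v & 0 < 1 - u + v].
Proof.
move=> H.
have [D0|D0] := leP 0 (u ^+ 2 - 4 * v).
  pose d := Num.sqrt (u ^+ 2 - 4 * v).
  have d2 : d ^+ 2 = u ^+ 2 - 4 * v by rewrite sqr_sqrtr.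
  have root x : x ^+ 2 + u * x + v = 0 -> x ^+ 2 < 1.
    move=> xr; have := H x%:C.
    rewrite -!rmorphXn -!rmorphM -!rmorphD /= xr => /(_ erefl).
    by rewrite normc_lt1 expr0n addr0.
  have := root ((- u + d) / 2); have := root ((- u - d) / 2).
  set x1 := (- u - d) / 2; set x2 := (- u + d) / 2.
  have uE : u = - (x1 + x2) by rewrite /x1 /x2; lra.
  have vE : v = x1 * x2.
    rewrite /x1 /x2 (_ : _ * _ = (u ^+ 2 - d ^+ 2) / 4); last by field.
    by rewrite d2; field.
  rewrite uE vE => h1 h2.
  have {}h1 : x1 ^+ 2 < 1 by apply: h1; ring.
  have {}h2 : x2 ^+ 2 < 1 by apply: h2; ring.
  have a1 : -1 < x1 < 1 by apply/andP; split; nra.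
  have a2 : -1 < x2 < 1 by apply/andP; split; nra.
  move: a1 a2 => /andP[? ?] /andP[? ?].
  by split; nra.
pose d := Num.sqrt (4 * v - u ^+ 2).
have d2 : d ^+ 2 = 4 * v - u ^+ 2 by rewrite sqr_sqrtr //; lra.
have := H ((- u / 2) +i* (d / 2))%C; rewrite normc_lt1.
have -> : (- u / 2) ^+ 2 + (d / 2) ^+ 2 = v.
  rewrite (_ : _ + _ = (u ^+ 2 + d ^+ 2) / 4); last by field.
  by rewrite d2; field.
have v0 : 0 <= v by nra.
move=> Hz; have v1 : v < 1.
  apply: Hz; apply/eqP; rewrite eq_complex /=.
  apply/andP; split; apply/eqP; last by field.
  rewrite [LHS](_ : _ = (4 * v - u ^+ 2 - d ^+ 2) / 4); last by field.
  by rewrite d2; field.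
by split => //; nra.
Qed.

(** The converse of [cubic_schur_stable], through the same factorization: each inequality is a
    product, or a sum of products, of quantities that are positive when [l] and the quadratic are
    stable. *)
Lemma schur_stable_cubic (R : rcfType) (p a b : R) :
  (forall m : R[i],
    m ^+ 3 + p%:C * m ^+ 2 + a%:C * m + b%:C = 0 -> normc (1 + m) < 1) ->
  [/\ 0 < b, 3 * b < 2 * a & (a - b) ^+ 2 + b < p * (a - b)].
Proof.
move=> H; have [m0 m0r] := cubic_real_root p a b.
pose l := 1 + m0.
have m0E : m0 = l - 1 by rewrite /l; ring.
have l1 : l ^+ 2 < 1.
  have := H m0%:C; rewrite -!rmorphXn -!rmorphM -!rmorphD /= m0r => /(_ erefl).
  by rewrite expr0n /= addr0 sqrtr_sqr ltr_norml /l => /andP[? ?]; nra.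
have la : -1 < l by nra.
have lb : l < 1 by nra.
pose u := l + p - 3; pose v := 3 - 2 * p + a + l * u.
have bE : b = a + 1 - p - l * v.
  by move: m0r; rewrite /v /u m0E; lra.
have [|v1 h1 h2] := @quadratic_schur_stable _ u v.
  move=> z zr; have -> : z = 1 + (z - 1) by ring.
  apply: H.
  transitivity ((z - l%:C) * (z ^+ 2 + u%:C * z + v%:C)).
    case: z {zr} => x y; apply/eqP; rewrite eq_complex /= bE /v /u.
    by apply/andP; split; apply/eqP; ring.
  by rewrite zr mulr0.
have w : 0 < 1 + l * u + l ^+ 2 * v.
  have [l0|l0] := leP 0 l.
    have lv : l * v <= l by nra.
    have : 0 < (1 - l) * (1 - l * v) by rewrite mulr_gt0//; lra.
    have : 0 <= l * (1 + u + v) by rewrite mulr_ge0// ltW.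
    lra.
  have lv : - l * v <= - l by nra.
  have : 0 < (1 + l) * (1 + l * v) by rewrite mulr_gt0//; lra.
  have : 0 <= - l * (1 - u + v) by rewrite mulr_ge0 ?oppr_ge0// ltW.
  lra.
have aE : a = v - 3 + 2 * p - l * u by rewrite /v; lra.
have pE : p = u - l + 3 by rewrite /u; lra.
split.
- have -> : b = (1 - l) * (1 + u + v) by rewrite bE aE pE; ring.
  by rewrite mulr_gt0//; lra.
- rewrite -subr_gt0.
  have -> : 2 * a - 3 * b = 2 * (1 - l) * (1 - v) + (1 + l) * (1 + u + v).
    by rewrite bE aE pE; ring.
  by rewrite addr_gt0// mulr_gt0//; lra.
- rewrite -subr_gt0.
  have -> : p * (a - b) - ((a - b) ^+ 2 + b) = (1 - v) * (1 + l * u + l ^+ 2 * v).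
    by rewrite bE aE pE; ring.
  by rewrite mulr_gt0//; lra.
Qed.

(** * Geometric decay *)

Definition geom_bounded (R : rcfType) (u : nat -> R[i]) : Prop :=
  exists c rho : R, [/\ 0 <= c, 0 < rho < 1 &
    forall k, normc (u k) <= c * rho ^+ k].

Lemma normc_ge0 (R : rcfType) (z : R[i]) : 0 <= normc z.
Proof. by case: z => a b; exact: sqrtr_ge0. Qed.

(** A first-order recurrence with stable factor [z] and geometrically small forcing decays
    geometrically. Enlarging the rate to some [s] above |z| avoids the polynomial factor of the
    resonant case |z| = rho. *)
Lemma geom_bounded_shift (R : rcfType) (u : nat -> R[i]) (z : R[i]) :
  normc z < 1 -> geom_bounded (fun k => u k.+1 - z * u k) ->
  geom_bounded u.
Proof.
move=> z1 [c [rho [c0 /andP[rho0 rho1] uP]]].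
have z0 := normc_ge0 z.
pose s := 1 - (1 - normc z) * (1 - rho) / 2.
have sz : 0 < s - normc z by rewrite /s; nra.
have rs : rho <= s by rewrite /s; nra.
have s1 : s < 1 by rewrite /s; nra.
have s0 : 0 < s by lra.
(* Chosen so that c + |z| d <= s d, which closes the induction. *)
pose d := normc (u 0%N) + c / (s - normc z).
have u0 := normc_ge0 (u 0%N).
have cd : c <= d * (s - normc z).
  rewrite /d mulrDl divfK ?gt_eqF// lerDr mulr_ge0//; lra.
have d0 : 0 <= d by rewrite /d addr_ge0// divr_ge0// ltW.
exists d, s; split => //; first by rewrite s0 s1.
elim=> [|k IH].
  by rewrite expr0 mulr1 /d lerDl divr_ge0// ltW.
have -> : u k.+1 = (u k.+1 - z * u k) + z * u k by rewrite subrK.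
apply: (le_trans (le_normcD _ _)).
rewrite normcM.
have sk0 : 0 <= s ^+ k by rewrite exprn_ge0// ltW.
have rsk : rho ^+ k <= s ^+ k by rewrite lerXn2r ?nnegrE// ltW.
have := uP k; rewrite exprS; move: (normc _) (normc (u k)) IH => e f.
move: (s ^+ k) (rho ^+ k) sk0 rsk => S P S0 PS fS eP.
have h1 : c * P <= c * S by rewrite ler_wpM2l.
have h2 : normc z * f <= normc z * (d * S) by rewrite ler_wpM2l.
have h3 : c * S <= d * (s - normc z) * S by rewrite ler_wpM2r.
lra.
Qed.

Lemma geom_bounded_cvg0 (R : realType) (u : nat -> R) :
  geom_bounded (fun k => (u k)%:C) -> (u @ \oo --> (0 : R))%classic.
Proof.
move=> [c [rho [c0 /andP[rho0 rho1] H]]]; apply/norm_cvg0P.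
apply: (@squeeze_cvgr _ _ _ _ (fun=> 0) (geometric c rho)).
- near=> k; rewrite normr_ge0 /=; have := H k.
  by rewrite /= expr0n addr0 sqrtr_sqr.
- exact: cvg_cst.
- by apply: cvg_geometric; rewrite ger0_norm// ltW.
Unshelve. all: by end_near. Qed.

Lemma iter_mulmxE (F : comNzRingType) (m : nat) (B : 'M[F]_m.+1)
    (e : 'cV_m.+1) (k : nat) :
  iter k (mulmx B) e = B ^+ k *m e.
Proof.
elim: k => [|k IH] /=; first by rewrite expr0 mul1mx.
by rewrite IH mulmxA exprS.
Qed.

Lemma map_iter_mulmx (aR rR : pzSemiRingType) (f : {rmorphism aR -> rR})
    (m q : nat) (A : 'M[aR]_m) (e : 'M[aR]_(m, q)) (k : nat) :
  iter k (mulmx (map_mx f A)) (map_mx f e) = map_mx f (iter k (mulmx A) e).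
Proof. by elim: k => //= k ->; rewrite map_mxM. Qed.

(** Induction on the list of roots: (B - z) e is annihilated by the remaining factors, and its
    trajectory is u (k + 1) - z u k for the trajectory u of e. No diagonalization is required. *)
Lemma geom_bounded_iter (R : rcfType) (m : nat) (B : 'M[R[i]]_m.+1)
    (s : seq R[i]) (e : 'cV_m.+1) :
  {in s, forall z, normc z < 1} ->
  horner_mx B (\prod_(z <- s) ('X - z%:P)) *m e = 0 ->
  forall i, geom_bounded (fun k => iter k (mulmx B) e i 0).
Proof.
elim: s e => [|z s IH] e s1 He i.
  exists 0, (1 / 2); split=> //; first by apply/andP; split; lra.
  move=> k; rewrite big_nil rmorph1 mul1mx in He.
  by rewrite iter_mulmxE He mulmx0 mxE normc0 mul0r.
apply: (@geom_bounded_shift _ _ z); first by apply: s1; rewrite mem_head.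
have [||c [rho [c0 rho1 H]]] := IH (B *m e - z *: e) _ _ i.
- by move=> w ws; apply: s1; rewrite inE ws orbT.
- move: He; rewrite big_cons mulrC rmorphM rmorphB /= horner_mx_X horner_mx_C.
  by rewrite -mulmxE -mulmxA mulmxBl mul_scalar_mx.
exists c, rho; split=> // k; have := H k.
rewrite !iter_mulmxE mulmxBr -scalemxAr mulmxA mulmxE -exprSr.
by rewrite !mxE.
Qed.

(** * Splitting off the generalized eigenspace of 1 *)

Lemma eigenvalue_trmx (F : fieldType) (m : nat) (M : 'M[F]_m) (z : F) :
  eigenvalue M^T z = eigenvalue M z.
Proof.
rewrite !eigenvalue_root_char; congr root.
rewrite /char_poly -[RHS]det_tr; congr (\det _).
by rewrite /char_poly_mx raddfB /= tr_scalar_mx map_trmx.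
Qed.

(** [eigenvalue] is defined by row vectors, whereas the dynamics acts on columns. *)
Lemma eigenvalue_colP (F : fieldType) (m : nat) (M : 'M[F]_m) (z : F) :
  reflect (exists2 v : 'cV_m, M *m v = z *: v & v != 0) (eigenvalue M z).
Proof.
rewrite -eigenvalue_trmx; apply: (iffP eigenvalueP) => -[v vM v0].
  exists v^T; last by rewrite trmx_eq0.
  by apply: trmx_inj; rewrite trmx_mul trmxK vM linearZ /= trmxK.
exists v^T; last by rewrite trmx_eq0.
by rewrite -trmx_mul vM linearZ.
Qed.

Lemma iter_unipotent_split (R : realType) (m : nat) (A : 'M[R]_m) :
  (forall z, eigenvalue (complex_mx A) z -> z = 1 \/ normc z < 1) ->
  forall v : 'cV_m, exists w : 'cV_m,
    (exists d, iter d (fun x => A *m x - x) w = 0) /\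
    (forall i, (fun k => iter k (mulmx A) v i 0 - iter k (mulmx A) w i 0)
      @ \oo --> (0 : R))%classic.
Proof.
case: m A => [|m] A HA v.
  by exists 0; split=> [|[]//]; exists 0%N.
have [d [q + cE]] := multiplicity_XsubC (char_poly A) 1.
have -> /= : char_poly A != 0 by rewrite monic_neq0// char_poly_monic.
move=> q1.
have /Bezout_eq1_coprimepP[[a b] /= ab] : coprimep (('X - 1%:P) ^+ d) q.
  by apply: coprimep_expl; rewrite coprimep_sym coprimep_XsubC.
(* The Bezout identity a (X - 1)^d + b q = 1 splits [v] into this part, killed by (A - 1)^d, and [e]
   below, killed by q(A); both claims come from Cayley-Hamilton. *)
exists (horner_mx A (b * q) *m v); split.
  exists d.
  have itE k x : iter k (fun x => A *m x - x) x =
      horner_mx A (('X - 1%:P) ^+ k) *m x.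
    elim: k => [|k IH] /=; first by rewrite expr0 rmorph1 mul1mx.
    rewrite IH exprS rmorphM rmorphB /= horner_mx_X horner_mx_C -mulmxE.
    by rewrite -mulmxA mulmxBl mul1mx.
  rewrite itE mulmxA mulmxE -rmorphM /= mulrCA [X in _ * X]mulrC -cE.
  by rewrite rmorphM /= Cayley_Hamilton mulr0 mul0mx.
pose e := horner_mx A (a * ('X - 1%:P) ^+ d) *m v.
have eE : v - horner_mx A (b * q) *m v = e.
  apply/eqP; rewrite subr_eq /e -mulmxDl -rmorphD /= ab rmorph1.
  by rewrite mul1mx.
have qe : horner_mx A q *m e = 0.
  rewrite /e mulmxA mulmxE -rmorphM /= mulrCA -cE.
  by rewrite rmorphM /= Cayley_Hamilton mulr0 mul0mx.
move=> i.
have [s sE] := closed_field_poly_normal (map_poly (real_complex R) q).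
have qc0 : lead_coef (map_poly (real_complex R) q) != 0.
  rewrite lead_coef_eq0 map_poly_eq0; apply: contraNneq q1 => ->.
  by rewrite root0.
have H := @geom_bounded_iter _ _ (complex_mx A) s (map_mx (real_complex R) e).
have : geom_bounded (fun k => (iter k (mulmx A) e i 0)%:C).
  have [||c [rho [c0 rho1 Hk]]] := H _ _ i.
  (* A root of [q] is an eigenvalue of [A], and it is not 1 since (X - 1)^d carries the full
     multiplicity. *)
  - move=> z zs.
    have zr : root (map_poly (real_complex R) q) z.
      by rewrite sE rootZ// root_prod_XsubC.
    have [] // := HA z.
      rewrite eigenvalue_root_char /complex_mx -map_char_poly cE rmorphM /=.
      by rewrite rootM zr.
    move=> z1; move: zr; rewrite z1 -(rmorph1 (real_complex R)) fmorph_root.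
    by rewrite (negbTE q1).
  - have /eqP := congr1 (map_mx (real_complex R)) qe.
    rewrite map_mxM map_mx0 map_horner_mx {1}sE linearZ /= -scalemxAl.
    by rewrite scaler_eq0 (negbTE qc0) /= => /eqP.
  exists c, rho; split=> // k; have := Hk k.
  by rewrite map_iter_mulmx mxE.
move=> /geom_bounded_cvg0 He.
rewrite [X in (X @ _)%classic](_ : _ = fun k => iter k (mulmx A) e i 0) //.
by apply/funext => k; rewrite !iter_mulmxE -eE mulmxBr !mxE.
Qed.

(** * Weighted Laplacians *)

Lemma laplacian_mulE (R : realType) (n : nat) (E : rel 'I_n)
    (alpha : 'I_n -> 'I_n -> R) (x : 'cV[R]_n) (i : 'I_n) :
  irreflexive E ->
  (laplacian E alpha *m x) i 0 =
    \sum_(k | E i k) alpha i k * (x i 0 - x k 0).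
Proof.
move=> hE; rewrite mxE (bigD1 i) //= mxE eqxx.
under [X in _ = X]eq_bigr do rewrite mulrBr.
rewrite sumrB -mulr_suml; congr (_ + _).
rewrite (bigID (E i)) /= [X in _ + X]big1 => [|k /andP[ki /negbTE Eik]]; last first.
  by rewrite mxE eq_sym (negbTE ki) Eik mul0r.
rewrite addr0 -sumrN; apply: eq_big => k.
  by case: (eqVneq k i) => //= ->; rewrite hE.
by move=> /andP[ki Eik]; rewrite mxE eq_sym (negbTE ki) Eik mulNr.
Qed.

Lemma laplacian_mul_max (R : realType) (n : nat) (E : rel 'I_n)
    (alpha : 'I_n -> 'I_n -> R) (x : 'cV[R]_n) (i : 'I_n) :
  irreflexive E -> (forall i j, E i j -> 0 < alpha i j) ->
  (forall j, x j 0 <= x i 0) -> 0 <= (laplacian E alpha *m x) i 0.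
Proof.
move=> hE ha xi; rewrite laplacian_mulE//.
by apply: sumr_ge0 => k Eik; rewrite mulr_ge0 ?subr_ge0// ltW// ha.
Qed.

(** At a maximal node, (L x) is a sum of nonnegative terms that is at most 0, so all its
    out-neighbours are maximal too. Maximality thus travels along a path to [root]. *)
Lemma laplacian_max_principle (R : realType) (n : nat) (E : rel 'I_n)
    (alpha : 'I_n -> 'I_n -> R) (x : 'cV[R]_n) (root : 'I_n) :
  irreflexive E -> (forall i j, E i j -> 0 < alpha i j) ->
  (forall i, connect E i root) ->
  (forall i, (laplacian E alpha *m x) i 0 <= 0) ->
  forall i, x i 0 <= x root 0.
Proof.
move=> hE ha hc hx i.
pose M := [arg max_(j > i) x j 0]%O.
have Mmax j : x j 0 <= x M 0 by rewrite /M; case: arg_maxP => // k _; apply.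
suff -> : x root 0 = x M 0 by [].
move: M Mmax => M Mmax.
have /connectP[q] := hc M; elim: q M Mmax => [|k q IH] l lmax /=.
  by move=> _ ->.
move=> /andP[Elk pq] rE.
suff kl : x k 0 = x l 0 by rewrite -kl; apply: IH => // j; rewrite kl.
have := hx l; rewrite laplacian_mulE// => le0.
have t0 j : E l j -> 0 <= alpha l j * (x l 0 - x j 0).
  by move=> Elj; rewrite mulr_ge0 ?subr_ge0// ltW// ha.
have /eqP : \sum_(j | E l j) alpha l j * (x l 0 - x j 0) = 0.
  by apply/eqP; rewrite eq_le le0 sumr_ge0.
rewrite psumr_eq0// => /allP/(_ k); rewrite mem_index_enum Elk => /(_ isT)/=.
by rewrite mulf_eq0 gt_eqF ?ha//= subr_eq0 => /eqP.
Qed.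

Lemma laplacian_ker (R : realType) (n : nat) (E : rel 'I_n)
    (alpha : 'I_n -> 'I_n -> R) (x : 'cV[R]_n) :
  irreflexive E -> (forall i j, E i j -> 0 < alpha i j) ->
  connected_digraph E -> laplacian E alpha *m x = 0 ->
  exists c, x = const_mx c.
Proof.
move=> hE ha [root hc] Lx; exists (x root 0).
apply/matrixP => i j; rewrite ord1 mxE; apply/eqP; rewrite eq_le.
apply/andP; split.
  by apply: (laplacian_max_principle hE ha hc) => k; rewrite Lx mxE.
have h k : (laplacian E alpha *m - x) k 0 <= 0.
  by rewrite mulmxN Lx oppr0 mxE.
by rewrite -lerN2; have := laplacian_max_principle hE ha hc h i; rewrite !mxE.
Qed.

Lemma laplacian_const (R : realType) (n : nat) (E : rel 'I_n)
    (alpha : 'I_n -> 'I_n -> R) (c : R) :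
  irreflexive E -> laplacian E alpha *m const_mx c = 0 :> 'cV_n.
Proof.
move=> hE; apply/matrixP => i j; rewrite ord1 laplacian_mulE//.
rewrite [RHS]mxE big1// => k _.
by rewrite !mxE subrr mulr0.
Qed.

(* A nonzero c would give x an entry that is extremal although L x has the
   wrong sign there; hence 0 is a semisimple eigenvalue of diag(r) L. *)
Lemma laplacian_image_inv_rates (R : realType) (n : nat) (E : rel 'I_n)
    (alpha : 'I_n -> 'I_n -> R) (r : 'rV[R]_n) (x : 'cV[R]_n) (c : R) :
  (0 < n)%N -> irreflexive E -> (forall i j, E i j -> 0 < alpha i j) ->
  (forall i, 0 < r 0 i) ->
  (forall i, (laplacian E alpha *m x) i 0 = c / r 0 i) -> c = 0.
Proof.
move=> n0 hE ha hr.
have pos (y : 'cV[R]_n) d :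
    (forall i, (laplacian E alpha *m y) i 0 = d / r 0 i) -> 0 <= d.
  move=> hy; pose i := [arg max_(j > Ordinal n0) y j 0]%O.
  have := @laplacian_mul_max _ _ E alpha y i hE ha.
  rewrite hy pmulr_lge0 ?invr_gt0//; apply => j.
  by rewrite /i; case: arg_maxP => // k _; apply.
move=> hx; apply/eqP; rewrite eq_le (pos x)// andbT -oppr_ge0.
by apply: (pos (- x)) => i; rewrite mulmxN mxE hx mulNr.
Qed.

(** For an eigenvector w with a positive entry, take the node l where x = R w is maximal: there w is
    positive and nu w = L x is nonnegative. *)
Lemma laplacian_eigenvalue_ge0 (R : realType) (n : nat) (E : rel 'I_n)
    (alpha : 'I_n -> 'I_n -> R) (r : 'rV[R]_n) (nu : R) :
  irreflexive E -> (forall i j, E i j -> 0 < alpha i j) ->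
  (forall i, 0 < r 0 i) ->
  eigenvalue (laplacian E alpha *m diag_mx r) nu -> 0 <= nu.
Proof.
move=> hE ha hr /eigenvalue_colP[w wE w0].
have [i wi] : exists i, w i 0 != 0.
  apply/existsP; apply: contraNT w0; rewrite negb_exists => /forallP h.
  by apply/eqP/matrixP => i j; rewrite ord1 mxE; apply/eqP; have := h i; rewrite negbK.
wlog wi0 : w wE w0 wi / 0 < w i 0.
  move=> H; move: (wi); rewrite neq_lt => /orP[wi'|]; last exact: H wE w0 wi.
  apply: (H (- w)).
  - by rewrite mulmxN wE scalerN.
  - by rewrite oppr_eq0.
  - by rewrite mxE oppr_eq0.
  - by rewrite mxE oppr_gt0.
pose x := diag_mx r *m w.
have xE j : x j 0 = r 0 j * w j 0 by rewrite /x mul_diag_mx mxE.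
pose l := [arg max_(j > i) x j 0]%O.
have lmax j : x j 0 <= x l 0 by rewrite /l; case: arg_maxP => // k _; apply.
have wl : 0 < w l 0.
  have : 0 < x l 0 by apply: lt_le_trans (lmax i); rewrite xE mulr_gt0.
  by rewrite xE pmulr_rgt0.
have := @laplacian_mul_max _ _ E alpha x l hE ha lmax.
by rewrite /x mulmxA wE mxE pmulr_lge0.
Qed.

Lemma eigenvalue_complex_mx (R : realType) (n : nat) (M : 'M[R]_n) (a : R) :
  eigenvalue (complex_mx M) a%:C = eigenvalue M a.
Proof.
by rewrite !eigenvalue_root_char /complex_mx -map_char_poly fmorph_root.
Qed.

(** The characteristic polynomial is a power of X, and its subleading coefficient is minus the
    trace. *)
Lemma trace_nilpotent (F : closedFieldType) (n : nat) (M : 'M[F]_n) :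
  (forall z, eigenvalue M z -> z = 0) -> \tr M = 0.
Proof.
case: n M => [|n] M H; first by rewrite /mxtrace big_ord0.
have [s] := closed_field_poly_normal (char_poly M).
have /eqP -> := char_poly_monic M; rewrite scale1r => sE.
have sn : size s = n.+1.
  by apply: succn_inj; have := congr1 (fun f : {poly F} => size f) sE;
    rewrite size_prod_XsubC size_char_poly.
apply: oppr_inj; rewrite oppr0 -char_poly_trace// sE.
rewrite (eq_big_seq (fun=> 'X)) => [|z zs]; last first.
  rewrite (H z) ?subr0// eigenvalue_root_char sE root_prod_XsubC//.
by rewrite big_const_seq count_predT iter_mulr_1 sn coefXn ltn_eqF.
Qed.

(** If mu were 0, every eigenvalue of L R would be 0 and so would its trace; but the diagonal is
    nonnegative and is positive at any node other than the root, which has an outgoing edge. *)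
Lemma largest_eigenvalue_gt0 (R : realType) (n : nat) (E : rel 'I_n)
    (alpha : 'I_n -> 'I_n -> R) (r : 'rV[R]_n) (mu : R) :
  (1 < n)%N -> irreflexive E -> (forall i j, E i j -> 0 < alpha i j) ->
  connected_digraph E -> (forall i, 0 < r 0 i) ->
  is_largest_eigenvalue (laplacian E alpha *m diag_mx r) mu -> 0 < mu.
Proof.
move=> n1 hE ha [root hc] hr [mu_eig mu_max].
have mu0 : 0 <= mu.
  apply: (@laplacian_eigenvalue_ge0 _ _ E alpha r) => //.
  by rewrite -eigenvalue_complex_mx.
rewrite lt_neqAle mu0 andbT; apply/eqP => muE.
have : \tr (complex_mx (laplacian E alpha *m diag_mx r)) = 0.
  apply: trace_nilpotent => z ze; have := mu_max z ze.
  rewrite lecE /= => /andP[/eqP zi zr].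
  have zE : z = (complex.Re z)%:C by apply/eqP; rewrite eq_complex -zi !eqxx.
  apply/eqP; rewrite eq_complex -zi /= eqxx andbT eq_le {1}muE zr /=.
  apply: (@laplacian_eigenvalue_ge0 _ _ E alpha r) => //.
  by rewrite -eigenvalue_complex_mx -zE.
rewrite /complex_mx trace_map_mx => /(congr1 (@complex.Re _)) /=.
apply/eqP; rewrite gt_eqF//.
have d0 i : 0 <= (laplacian E alpha *m diag_mx r) i i.
  rewrite mul_mx_diag !mxE eqxx mulr_ge0 ?(ltW (hr _))//.
  by apply: sumr_ge0 => k Eik; rewrite ltW ?ha.
have [i iroot] : exists i, i != root.
  by have := n1; rewrite -{1}(card_ord n) => /card_gt1P[a [b [_ _ ab]]];
     case: (eqVneq a root) => [ar|]; [exists b; rewrite -ar eq_sym|exists a].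
have [k Eik] : exists k, E i k.
  have /connectP[[|k q] /=] := hc i.
    by move=> _ ir; rewrite ir eqxx in iroot.
  by move=> /andP[Eik _] _; exists k.
rewrite /mxtrace (bigD1 i)//= ltr_wpDr ?sumr_ge0//.
rewrite mul_mx_diag !mxE eqxx mulr_gt0// (bigD1 k)//= ltr_wpDr ?ha//.
by apply: sumr_ge0 => j /andP[Eij _]; rewrite ltW ?ha.
Qed.

(** * The system matrix *)

(** Stated for a ring morphism [f] so that one computation serves the real system and its
    complexification. *)
Lemma system_mulE (R : realType) (F : comNzRingType)
    (f : {rmorphism R -> F}) (n : nat) (L : 'M[R]_n) (r : 'rV[R]_n)
    (tau kappa1 kappa2 p : R) (x s y : 'cV[F]_n) :
  map_mx f (system_matrix L r tau kappa1 kappa2 p) *m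
    col_mx x (col_mx s y) =
  col_mx (x + f tau *: (map_mx f (diag_mx r) *m s))
    (col_mx (s - f kappa1 *: (map_mx f L *m x) - f kappa2 *: y)
            ((1 - f p) *: y - f p *: (map_mx f L *m x))).
Proof.
rewrite /system_matrix map_block_mx map_row_mx map_col_mx map_block_mx.
rewrite mul_block_col mul_row_col mul_col_mx mul_block_col add_col_mx.
rewrite !map_mxZ !map_scalar_mx !map_mx0 !(rmorphN f) (rmorphB f) !(rmorph1 f).
rewrite !mul0mx !addr0 !add0r !mul1mx !mul_scalar_mx -!scalemxAl !scaleNr.
by congr (col_mx _ (col_mx _ _)); [rewrite addrCA addrA | rewrite addrC].
Qed.

Lemma system_mul (R : realType) (n : nat) (L : 'M[R]_n) (r : 'rV[R]_n)
    (tau kappa1 kappa2 p : R) (x s y : 'cV[R]_n) :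
  system_matrix L r tau kappa1 kappa2 p *m col_mx x (col_mx s y) =
  col_mx (x + tau *: (diag_mx r *m s))
    (col_mx (s - kappa1 *: (L *m x) - kappa2 *: y)
            ((1 - p) *: y - p *: (L *m x))).
Proof.
have := system_mulE (idfun : {rmorphism R -> R}) L r tau kappa1 kappa2 p x s y.
by rewrite !map_mx_id.
Qed.

(* With m = z - 1 and nu the eigenvalue of L R attached to the s-component of
   an eigenvector, eliminating x and y leaves the cubic
   m^3 + p m^2 + tau nu kappa1 m + tau nu p (kappa1 - kappa2). *)
Lemma system_eigenvalue (R : realType) (n : nat) (L : 'M[R]_n)
    (r : 'rV[R]_n) (tau kappa1 kappa2 p mu : R) :
  0 < tau ->
  (forall nu, eigenvalue (complex_mx (L *m diag_mx r)) nu ->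
    exists2 nu' : R, nu = nu'%:C & 0 <= nu' <= mu) ->
  `|1 - p| < 1 ->
  (forall nu : R, 0 < nu <= mu -> forall m : R[i],
    m ^+ 3 + p%:C * m ^+ 2 + (tau * nu * kappa1)%:C * m
      + (tau * nu * (p * (kappa1 - kappa2)))%:C = 0 -> normc (1 + m) < 1) ->
  forall z, eigenvalue (complex_mx (system_matrix L r tau kappa1 kappa2 p)) z ->
    z = 1 \/ normc z < 1.
Proof.
move=> tau0 Hnu p1 Hcub z /eigenvalue_colP[v vE v0].
pose m := z - 1.
have zE : z = 1 + m by rewrite /m; ring.
have [m0|m0] := eqVneq m 0; first by left; rewrite zE m0 addr0.
right.
have [mp|mp] := eqVneq (m + p%:C) 0.
  have -> : z = (1 - p)%:C.
    by rewrite zE rmorphB rmorph1 /=; move/eqP: mp; rewrite addr_eq0 => /eqP ->.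
  by rewrite /= expr0n addr0 sqrtr_sqr.
move: vE v0; rewrite -[v]vsubmxK -[dsubmx v]vsubmxK.
move: (usubmx v) (usubmx (dsubmx v)) (dsubmx (dsubmx v)) => x s y.
rewrite /complex_mx system_mulE !scale_col_mx /=.
move=> /eq_col_mx[xE /eq_col_mx[sE yE]] v0.
set Lc := map_mx (real_complex R) L in sE yE.
set Rc := map_mx (real_complex R) (diag_mx r) in xE.
have {}xE : m *: x = tau%:C *: (Rc *m s).
  by rewrite /m scalerBl scale1r -xE addrC addKr.
have {}sE : m *: s = - (kappa1%:C *: (Lc *m x)) - kappa2%:C *: y.
  by rewrite /m scalerBl scale1r -sE addrC !addrA addNr add0r.
have {}yE : (m + p%:C) *: y = - (p%:C *: (Lc *m x)).
  move: yE; move: (Lc *m x) => X yE; apply/colP => i.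
  have := congr1 (fun M : 'cV_n => M i 0) yE; rewrite /m !mxE.
  by move=> h; rewrite mulrDl mulrBl -h; ring.
(* If s = 0, then m x = 0 and (m + p) y = -p L x force x = y = 0. *)
have s0 : s != 0.
  apply: contraNneq v0 => s0; move: xE; rewrite s0 mulmx0 scaler0 => /eqP.
  rewrite scaler_eq0 (negbTE m0) /= => /eqP x0.
  move: yE; rewrite x0 mulmx0 scaler0 oppr0 => /eqP.
  by rewrite scaler_eq0 (negbTE mp) /= => /eqP ->; rewrite !col_mx0.
(* Eliminating x and y gives m^2 (m + p) s = -c L R s, so -m^2 (m + p) / c is an eigenvalue of L R;
   neither c nor this eigenvalue vanishes, as m and m + p are nonzero. *)
pose c := tau%:C * (kappa1%:C * (m + p%:C) - kappa2%:C * p%:C).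
have key : (m ^+ 2 * (m + p%:C)) *: s = - c *: (Lc *m Rc *m s).
  have mX : m *: (Lc *m x) = tau%:C *: (Lc *m (Rc *m s)).
    by rewrite scalemxAr xE -scalemxAr.
  move: mX sE yE; rewrite -mulmxA; move: (Lc *m x) (Lc *m (Rc *m s)) => X Y.
  move=> XY sE yE; apply/colP => i.
  have := congr1 (fun M : 'cV_n => M i 0) XY.
  have := congr1 (fun M : 'cV_n => M i 0) sE.
  have := congr1 (fun M : 'cV_n => M i 0) yE.
  rewrite !mxE => h1 h2 h3.
  have -> : m ^+ 2 * (m + p%:C) * s i 0 = m * (m + p%:C) * (m * s i 0) by ring.
  rewrite h2.
  have -> : m * (m + p%:C) * (- (kappa1%:C * X i 0) - kappa2%:C * y i 0) =
    - (m + p%:C) * kappa1%:C * (m * X i 0) - m * kappa2%:C * ((m + p%:C) * y i 0).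
    by ring.
  rewrite h1.
  have -> : m * kappa2%:C * - (p%:C * X i 0) = - (kappa2%:C * p%:C) * (m * X i 0).
    by ring.
  by rewrite h3 /c; ring.
have c0 : c != 0.
  apply: contraNneq s0 => c0; move/eqP: key.
  by rewrite c0 oppr0 scale0r scaler_eq0 mulf_eq0 sqrf_eq0 (negbTE m0) (negbTE mp).
have [|nu nuE /andP[nu0 num]] := Hnu (- (m ^+ 2 * (m + p%:C)) / c).
  apply/eigenvalue_colP; exists s => //.
  rewrite /complex_mx map_mxM -/Lc -/Rc mulrC -scalerA scaleNr key scaleNr.
  by rewrite opprK scalerA mulVf// scale1r.
have nuE' : m ^+ 2 * (m + p%:C) + nu%:C * c = 0.
  by rewrite -nuE divfK// subrr.
rewrite zE; apply: (Hcub nu).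
  rewrite num andbT lt_neqAle nu0 andbT; apply/eqP => nu00.
  move/eqP: nuE'; rewrite -nu00 mul0r addr0.
  by rewrite mulf_eq0 sqrf_eq0 (negbTE m0) (negbTE mp).
rewrite -nuE' /c !rmorphM /= rmorphB /=; ring.
Qed.

(** * Kernels of the powers of A - 1 *)

Definition increment (R : realType) (n : nat) (A : 'M[R]_n) (v : 'cV[R]_n) :=
  A *m v - v.

Lemma system_increment (R : realType) (n : nat) (L : 'M[R]_n) (r : 'rV[R]_n)
    (tau kappa1 kappa2 p : R) (x s y : 'cV[R]_n) :
  increment (system_matrix L r tau kappa1 kappa2 p) (col_mx x (col_mx s y)) =
  col_mx (tau *: (diag_mx r *m s))
    (col_mx (- (kappa1 *: (L *m x)) - kappa2 *: y) (- (p *: (y + L *m x)))).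
Proof.
rewrite /increment system_mul !opp_col_mx !add_col_mx.
move: (L *m x) (diag_mx r *m s) => X S.
by congr (col_mx _ (col_mx _ _)); apply/colP => i; rewrite !mxE; ring.
Qed.

Section GeneralizedKernel.
Variables (R : realType) (n : nat) (E : rel 'I_n).
Variables (alpha : 'I_n -> 'I_n -> R) (r : 'rV[R]_n).
Variables (tau kappa1 kappa2 p : R).
Hypotheses (n_gt0 : (0 < n)%N) (E_irr : irreflexive E).
Hypothesis E_conn : connected_digraph E.
Hypothesis alpha_gt0 : forall i j, E i j -> 0 < alpha i j.
Hypothesis r_gt0 : forall i, 0 < r 0 i.
Hypotheses (tau_gt0 : 0 < tau) (p_neq0 : p != 0).
Hypothesis kappa_neq : kappa1 != kappa2.

Let L := laplacian E alpha.
Let A := system_matrix L r tau kappa1 kappa2 p.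

(** The synchronized states: all clocks read [c], and the corrections compensate the rates so that
    each clock gains [d] per step. *)
Let drift (c d : R) : 'cV[R]_(n + (n + n)) :=
  col_mx (const_mx c) (col_mx (\col_i (d / (tau * r 0 i))) 0).

Lemma scaled_rates (s : 'cV[R]_n) (c : R) :
  tau *: (diag_mx r *m s) = const_mx c -> s = \col_i (c / (tau * r 0 i)).
Proof.
move=> sE; apply/colP => i; have := congr1 (fun M : 'cV_n => M i 0) sE.
rewrite mxE mul_diag_mx !mxE => <-; rewrite mulrA [_ * s i 0]mulrC mulfK//.
by rewrite mulf_neq0 ?gt_eqF.
Qed.

Lemma increment_drift (c d : R) : increment A (drift c d) = drift d 0.
Proof.
rewrite system_increment /L laplacian_const// !scaler0 oppr0 !addr0 scaler0.
rewrite oppr0; congr (col_mx _ (col_mx _ _)); apply/colP => i.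
  rewrite mxE mul_diag_mx !mxE mulrA mulrC divfK//.
  by rewrite mulf_neq0 ?gt_eqF.
by rewrite !mxE mul0r.
Qed.

(** The last block gives y = -L x, so the middle one makes L x a multiple of the inverse rates,
    hence 0. This stops the Jordan chains at 1 after two steps. *)
Lemma increment_eq_drift (v : 'cV[R]_(n + (n + n))) (c d : R) :
  increment A v = drift c d -> d = 0 /\ exists c', v = drift c' c.
Proof.
rewrite -[v]vsubmxK -[dsubmx v]vsubmxK.
move: (usubmx v) (usubmx (dsubmx v)) (dsubmx (dsubmx v)) => x s y.
rewrite system_increment => /eq_col_mx[/scaled_rates sE /eq_col_mx[dE yE]].
have yLx : y = - (L *m x).
  move/eqP: yE; rewrite oppr_eq0 scaler_eq0 (negbTE p_neq0) /= addr_eq0.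
  by move/eqP.
have k21 : kappa2 - kappa1 != 0 by rewrite subr_eq0 eq_sym.
have LxE i : (L *m x) i 0 = d / (tau * (kappa2 - kappa1)) / r 0 i.
  have := congr1 (fun M : 'cV_n => M i 0) dE; rewrite yLx.
  move: (L *m x) => X; rewrite !mxE => h.
  apply: (mulfI k21); rewrite (_ : _ * X i 0 = d / (tau * r 0 i)).
    by field; rewrite k21 !gt_eqF.
  by rewrite -h; ring.
have d0 : d = 0.
  have /eqP := laplacian_image_inv_rates n_gt0 E_irr alpha_gt0 r_gt0 LxE.
  rewrite mulf_eq0 invr_eq0 mulf_eq0 (negbTE k21) (gt_eqF tau_gt0) !orbF.
  by move/eqP.
have Lx0 : L *m x = 0.
  by apply/colP => i; rewrite LxE d0 !mul0r mxE.
have [c' xE] := laplacian_ker E_irr alpha_gt0 E_conn Lx0.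
by split=> //; exists c'; rewrite sE yLx Lx0 oppr0 xE.
Qed.

Lemma iter_increment_eq_drift (k : nat) (v : 'cV[R]_(n + (n + n))) (c d : R) :
  iter k (increment A) v = drift c d -> exists c' d', v = drift c' d'.
Proof.
elim: k v c d => [|k IH] v c d; first by move=> /= ->; exists c, d.
rewrite iterSr => /IH[c1 [d1 /increment_eq_drift[_ [c2 ->]]]].
by exists c2, c1.
Qed.

Lemma iter_drift (c d : R) (k : nat) :
  iter k (mulmx A) (drift c d) = drift (c + k%:R * d) d.
Proof.
elim: k => [|k IH]; first by rewrite mul0r addr0.
rewrite iterS IH -[LHS](subrK (drift (c + k%:R * d) d)).
rewrite -/(increment A _) increment_drift.
rewrite !add_col_mx addr0; congr (col_mx _ (col_mx _ _)); apply/colP => i.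
  by rewrite !mxE -addn1 natrD; ring.
by rewrite !mxE mul0r add0r.
Qed.

Lemma unipotent_clocks (w : 'cV[R]_(n + (n + n))) (k : nat) :
  iter k (increment A) w = 0 ->
  exists c d, forall j i, clocks (iter j (mulmx A) w) i 0 = c + j%:R * d.
Proof.
move=> w0; have [|c [d ->]] := @iter_increment_eq_drift k w 0 0.
  rewrite w0 /drift (_ : (\col_i (0 / (tau * r 0 i))) = 0) ?col_mx0//.
  by apply/colP => i; rewrite !mxE mul0r.
by exists c, d => j i; rewrite iter_drift /clocks col_mxKu mxE.
Qed.

End GeneralizedKernel.

(** * Synchronization *)

Lemma iter_modal (R : realType) (n : nat) (L : 'M[R]_n) (r : 'rV[R]_n)
    (tau kappa1 kappa2 p nu : R) (w : 'cV[R]_n) (a b c : nat -> R) (k : nat) :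
  L *m diag_mx r *m w = nu *: w ->
  (forall k, a k.+1 = a k + tau * b k) ->
  (forall k, b k.+1 = b k - kappa1 * nu * a k - kappa2 * c k) ->
  (forall k, c k.+1 = (1 - p) * c k - p * nu * a k) ->
  iter k (mulmx (system_matrix L r tau kappa1 kappa2 p))
    (col_mx (a 0 *: (diag_mx r *m w)) (col_mx (b 0 *: w) (c 0 *: w))) =
  col_mx (a k *: (diag_mx r *m w)) (col_mx (b k *: w) (c k *: w)).
Proof.
move=> wE aE bE cE; elim: k => // k IH.
rewrite iterS IH system_mul -!scalemxAr mulmxA wE aE bE cE.
move: (diag_mx r *m w) => x.
by congr (col_mx _ (col_mx _ _)); apply/colP => i; rewrite !mxE; ring.
Qed.

Lemma eq_fun_cvg (R : realType) (f g : nat -> R) (l : R) :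
  f =1 g -> (f @ \oo --> l)%classic -> (g @ \oo --> l)%classic.
Proof. by move=> /funext ->. Qed.

(** Real and imaginary parts of a complex modal solution are real modal solutions, so z^k tends to
    0, which |z| >= 1 forbids. *)
Lemma modal_normc_lt1 (R : realType) (tau kappa1 kappa2 p nu : R) :
  (forall a b c : nat -> R,
    (forall k, a k.+1 = a k + tau * b k) ->
    (forall k, b k.+1 = b k - kappa1 * nu * a k - kappa2 * c k) ->
    (forall k, c k.+1 = (1 - p) * c k - p * nu * a k) ->
    (a @ \oo --> (0 : R))%classic) ->
  forall (z : R[i]) (b c : nat -> R[i]),
    (forall k, z ^+ k.+1 = z ^+ k + tau%:C * b k) ->
    (forall k, b k.+1 = b k - (kappa1 * nu)%:C * z ^+ k - kappa2%:C * c k) ->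
    (forall k, c k.+1 = (1 - p)%:C * c k - (p * nu)%:C * z ^+ k) ->
    normc z < 1.
Proof.
move=> H z b c zE bE cE.
have ReM (x : R) (y : R[i]) : complex.Re (x%:C * y) = x * complex.Re y.
  by case: y => y1 y2 /=; ring.
have ImM (x : R) (y : R[i]) : complex.Im (x%:C * y) = x * complex.Im y.
  by case: y => y1 y2 /=; ring.
have ReD (x y : R[i]) : complex.Re (x + y) = complex.Re x + complex.Re y.
  by case: x y => ? ? [].
have ImD (x y : R[i]) : complex.Im (x + y) = complex.Im x + complex.Im y.
  by case: x y => ? ? [].
have ReN (x : R[i]) : complex.Re (- x) = - complex.Re x by case: x.
have ImN (x : R[i]) : complex.Im (- x) = - complex.Im x by case: x.
have hR : ((fun k => complex.Re (z ^+ k)) @ \oo --> (0 : R))%classic.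
  apply: (H _ (fun k => complex.Re (b k)) (fun k => complex.Re (c k))) => k.
  - by rewrite zE ReD ReM.
  - by rewrite bE !ReD !ReN !ReM.
  - by rewrite cE ReD ReN !ReM.
have hI : ((fun k => complex.Im (z ^+ k)) @ \oo --> (0 : R))%classic.
  apply: (H _ (fun k => complex.Im (b k)) (fun k => complex.Im (c k))) => k.
  - by rewrite zE ImD ImM.
  - by rewrite bE !ImD !ImN !ImM.
  - by rewrite cE ImD ImN !ImM.
rewrite ltNge; apply/negP => z1.
have normX k : 1 <= normc (z ^+ k).
  elim: k => [|k IH]; first by rewrite expr0 normc1.
  by rewrite exprS normcM; apply: le_trans IH _; rewrite ler_peMl// normc_ge0.
have h : ((fun k => complex.Re (z ^+ k) * complex.Re (z ^+ k)
      + complex.Im (z ^+ k) * complex.Im (z ^+ k)) 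
      @ \oo --> (0 * 0 + 0 * 0 : R))%classic.
  by apply: cvgD; apply: cvgM.
rewrite !mul0r addr0 in h.
have : 1 <= (0 : R).
  apply: (cvgr_to_ge h); near=> k.
  have := normX k; case: (z ^+ k) => x y /= h1.
  have : 1 <= x ^+ 2 + y ^+ 2 by rewrite leNgt -normc_lt1 /= -leNgt.
  by rewrite !expr2.
by rewrite ler10.
Unshelve. all: by end_near. Qed.

Section Synchronization.
Variables (R : realType) (n : nat) (E : rel 'I_n).
Variables (alpha : 'I_n -> 'I_n -> R) (r : 'rV[R]_n).
Variables (t0 tau kappa1 kappa2 p mu : R).
Hypotheses (n_gt1 : (1 < n)%N) (E_irr : irreflexive E).
Hypothesis E_conn : connected_digraph E.
Hypothesis alpha_gt0 : forall i j, E i j -> 0 < alpha i j.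
Hypothesis r_gt0 : forall i, 0 < r 0 i.
Hypothesis tau_gt0 : 0 < tau.

Let L := laplacian E alpha.
Let A := system_matrix L r tau kappa1 kappa2 p.

Hypothesis mu_largest : is_largest_eigenvalue (L *m diag_mx r) mu.

Let mu_gt0 : 0 < mu.
Proof. exact: largest_eigenvalue_gt0 mu_largest. Qed.

Lemma sync_modal_cvg0 (nu : R) (w : 'cV[R]_n) (a b c : nat -> R) :
  achieves_synchronization A t0 tau ->
  L *m diag_mx r *m w = nu *: w -> w != 0 -> nu != 0 ->
  (forall k, a k.+1 = a k + tau * b k) ->
  (forall k, b k.+1 = b k - kappa1 * nu * a k - kappa2 * c k) ->
  (forall k, c k.+1 = (1 - p) * c k - p * nu * a k) ->
  (a @ \oo --> (0 : R))%classic.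
Proof.
move=> sync wE w0 nu0 aE bE cE.
pose x := diag_mx r *m w.
(* A constant x would give nu w = L x = 0. The difference of clocks i and j cancels the common
   affine reference and leaves a multiple of [a]. *)
have [i [j xij]] : exists i j, x i 0 - x j 0 != 0.
  pose i0 := Ordinal (ltnW n_gt1).
  suff /existsP[j ?] : [exists j, x i0 0 - x j 0 != 0] by exists i0, j.
  apply: contraT; rewrite negb_exists => /forallP h.
  have xE : x = const_mx (x i0 0).
    apply/colP => j; have := h j; rewrite negbK subr_eq0 => /eqP ->.
    by rewrite [RHS]mxE.
  move: wE; rewrite -mulmxA -/x xE laplacian_const// => /eqP.
  by rewrite eq_sym scaler_eq0 (negbTE nu0) (negbTE w0).
have [rs [xs H]] := sync (col_mx (a 0 *: x) (col_mx (b 0 *: w) (c 0 *: w))).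
have xk k l :
    clocks (state A (col_mx (a 0 *: x) (col_mx (b 0 *: w) (c 0 *: w))) k) l 0 = a k * x l 0.
  by rewrite /state (iter_modal _ wE aE bE cE) /clocks col_mxKu [LHS]mxE.
have lim : ((fun k => (x i 0 - x j 0)^-1 *
    ((a k * x i 0 - (rs * (sample_time t0 tau k - t0) + xs)) -
     (a k * x j 0 - (rs * (sample_time t0 tau k - t0) + xs))))
    @ \oo --> (x i 0 - x j 0)^-1 * (0 - 0))%classic.
  apply: cvgM; first exact: cvg_cst.
  by apply: cvgB; [apply: eq_fun_cvg (H i)|apply: eq_fun_cvg (H j)] => k;
    rewrite /= xk.
rewrite subrr mulr0 in lim; apply: eq_fun_cvg lim => k.
rewrite [X in _ * X](_ : _ = a k * (x i 0 - x j 0)); last by ring.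
by rewrite mulrC mulfK.
Qed.

(** The mode nu = 0 with w the inverse rates: all clocks equal [a], and the second difference
    removes the affine reference. *)
Lemma sync_modal0 (a b c : nat -> R) :
  achieves_synchronization A t0 tau ->
  (forall k, a k.+1 = a k + tau * b k) ->
  (forall k, b k.+1 = b k - kappa2 * c k) ->
  (forall k, c k.+1 = (1 - p) * c k) ->
  ((fun k => a k.+2 - 2 * a k.+1 + a k) @ \oo --> (0 : R))%classic.
Proof.
move=> sync aE bE cE.
pose w : 'cV[R]_n := \col_i (r 0 i)^-1.
have xE : diag_mx r *m w = const_mx 1.
  by apply/colP => i; rewrite mul_diag_mx !mxE divff// gt_eqF.
have wE : L *m diag_mx r *m w = 0 *: w.
  by rewrite -mulmxA xE laplacian_const// scale0r.
have [rs [xs H]] :=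
  sync (col_mx (a 0 *: (diag_mx r *m w)) (col_mx (b 0 *: w) (c 0 *: w))).
have {H} := H (Ordinal (ltnW n_gt1)).
set u := fun k => _; move=> H.
have uE k : u k = a k - (rs * (k%:R * tau) + xs).
  rewrite /u /state (@iter_modal _ _ _ _ _ _ _ _ 0 w a b c) //.
  - rewrite /clocks col_mxKu xE !mxE mulr1 /sample_time; congr (_ - (_ * _ + _)).
    by rewrite addrC addKr.
  - by move=> j; rewrite bE mulr0 mul0r subr0.
  - by move=> j; rewrite cE mulr0 mul0r subr0.
have H1 : ((fun k => u k.+1) @ \oo --> (0 : R))%classic by rewrite cvg_shiftS.
have H2 : ((fun k => u k.+2) @ \oo --> (0 : R))%classic.
  by rewrite (cvg_shiftS (fun k => u k.+1)).
have lim : ((fun k => u k.+2 - 2 * u k.+1 + u k)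
    @ \oo --> (0 - 2 * 0 + 0 : R))%classic.
  apply: cvgD => //; apply: cvgB => //; apply: cvgM => //; exact: cvg_cst.
rewrite mulr0 subrr addr0 in lim; apply: eq_fun_cvg lim => k.
by rewrite !uE -[k.+2]addn2 -[k.+1]addn1 !natrD; ring.
Qed.

Lemma sync_conditions :
  achieves_synchronization A t0 tau ->
  [/\ `|1 - p| < 1, 0 < kappa1 - kappa2 < (2 * kappa1) / (3 * p)
    & tau < (p * (kappa2 - p * (kappa1 - kappa2))) /
            (mu * (kappa1 - p * (kappa1 - kappa2)) ^+ 2)].
Proof.
move=> sync.
have [w wE w0] : exists2 w : 'cV[R]_n, L *m diag_mx r *m w = mu *: w & w != 0.
  by apply/eigenvalue_colP; rewrite -eigenvalue_complex_mx; case: mu_largest.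
have mu0 : mu != 0 by rewrite gt_eqF.
have tau0 : tau != 0 by rewrite gt_eqF.
have tauC : tau%:C != 0 by rewrite fmorph_eq0.
have Hr a b c := @sync_modal_cvg0 mu w a b c sync wE w0 mu0.
have Hc := modal_normc_lt1 Hr.
(* Without kappa2, (a, b) decouples from c and has modes 1 + m, 1 - m with m^2 = -tau mu kappa1;
   both cannot lie in the open disc, since they sum to 2. *)
have k20 : kappa2 != 0.
  apply/eqP => k20.
  pose m := sqrtc ((- (tau * mu * kappa1))%:C).
  have mm (e : R[i]) : e ^+ 2 = m ^+ 2 -> normc (1 + e) < 1.
    move=> em; have e2 : e ^+ 2 = (- (tau * mu * kappa1))%:C.
      by rewrite em /m sqr_sqrtc.
    apply: (Hc _ (fun k => (1 + e) ^+ k * e / tau%:C)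
      (fun k => iteri k (fun j c =>
         (1 - p)%:C * c - (p * mu)%:C * (1 + e) ^+ j) 0)).
    - by move=> k; rewrite exprS [tau%:C * _]mulrC divfK//; ring.
    - move=> k; rewrite k20 mul0r subr0.
      rewrite (_ : _ / _ = (1 + e) ^+ k * e / tau%:C +
        (1 + e) ^+ k * e ^+ 2 / tau%:C).
        congr (_ + _); rewrite e2 rmorphN !rmorphM /=.
        by field.
      by rewrite exprS; ring.
    - by [].
  have h1 := mm m erefl; have h2 := mm (- m) (sqrrN m).
  have := le_normcD (1 + m) (1 - m).
  have -> : (1 + m) + (1 - m) = 2%:C by rewrite rmorph_nat; ring.
  have -> : normc (2%:C : R[i]) = 2.
    by rewrite /= expr0n addr0 sqrtr_sqr ger0_norm.
  by move=> /le_lt_trans/(_ (ltrD h1 h2)); rewrite -[1 + 1]/(2 : R) ltxx.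
have p0 : p != 0.
  apply/eqP => p0.
  (* With p = 0 the mode has a stationary solution with a = 1, kappa2 c balancing kappa1 mu a. *)
  have : ((fun=> 1 : R) @ \oo --> (0 : R))%classic.
    apply: (Hr _ (fun=> 0) (fun=> - (kappa1 * mu / kappa2))) => k.
    - by rewrite mulr0 addr0.
    - by field.
    - by rewrite p0; ring.
  move=> /(cvg_unique (@norm_hausdorff _ _) (@cvg_cst _ (1 : R) _ _ _)).
  by move/eqP; rewrite oner_eq0.
have p1 : `|1 - p| < 1.
  rewrite ltNge; apply/negP => q1.
  pose q := 1 - p.
  (* With a = q^k, the recurrences dictate b and c; the second difference is p^2 q^k, which stays
     away from 0 when |q| >= 1. *)
  have sync0 := @sync_modal0 (fun k => q ^+ k) (fun k => q ^+ k * (q - 1) / tau)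
    (fun k => q ^+ k * (q - 1) * (1 - q) / (tau * kappa2)) sync.
  have h1 k : q ^+ k.+1 = q ^+ k + tau * (q ^+ k * (q - 1) / tau).
    by rewrite exprS; field.
  have h2 k : q ^+ k.+1 * (q - 1) / tau = q ^+ k * (q - 1) / tau -
      kappa2 * (q ^+ k * (q - 1) * (1 - q) / (tau * kappa2)).
    by rewrite exprS; field; rewrite tau0 k20.
  have h3 k : q ^+ k.+1 * (q - 1) * (1 - q) / (tau * kappa2) =
      (1 - p) * (q ^+ k * (q - 1) * (1 - q) / (tau * kappa2)).
    by rewrite exprS -/q; ring.
  have H := sync0 h1 h2 h3.
  have H0 : ((fun k => p ^+ 2 * q ^+ k) @ \oo --> (0 : R))%classic.
    by apply: eq_fun_cvg H => k; rewrite !exprS /q; ring.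
  have H1 : ((fun k => `|p ^+ 2 * q ^+ k|) @ \oo --> (0 : R))%classic.
    exact/norm_cvg0P.
  have : p ^+ 2 <= 0.
    apply: (cvgr_to_ge H1); near=> k.
    rewrite normrM ger0_norm ?sqr_ge0// ler_peMr ?sqr_ge0//.
    by rewrite normrX exprn_ege1.
  by rewrite leNgt exprn_even_gt0 //= p0.
have tm : 0 < tau * mu by rewrite mulr_gt0.
have [|b0 ab hH] := @schur_stable_cubic _ p (tau * mu * kappa1)
    (tau * mu * (p * (kappa1 - kappa2))).
  move=> m mE.
  (* The cubic takes the nonzero value -tau mu p kappa2 at -p; this permits the division by m + p in
     the modal solution below. *)
  have mp : m + p%:C != 0.
    apply/eqP => mp; have mE' : m = (- p)%:C.
      by rewrite rmorphN; apply/eqP; rewrite -addr_eq0 mp.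
    move: mE; rewrite mE' -!rmorphXn -!rmorphM -!rmorphD.
    move=> /(congr1 (@complex.Re _)) /= /eqP; rewrite (_ : _ + _ = - (tau * mu * p * kappa2)); last by ring.
    rewrite oppr_eq0 !mulf_eq0 (negbTE tau0) (negbTE mu0) (negbTE p0).
    by rewrite (negbTE k20).
  apply: (Hc _ (fun k => (1 + m) ^+ k * m / tau%:C)
     (fun k => (1 + m) ^+ k * - (p * mu)%:C / (m + p%:C))).
  - by move=> k; rewrite exprS [tau%:C * _]mulrC divfK//; ring.
  - move=> k; apply/eqP; rewrite -subr_eq0; apply/eqP.
    rewrite -[RHS](mulr0 ((1 + m) ^+ k / (tau%:C * (m + p%:C)))) -mE exprS.
    rewrite !rmorphM !rmorphB /=; field.
    by rewrite tauC mp.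
  - move=> k; rewrite exprS rmorphB /=; field.
    by rewrite mp.
have [pp0 pp2] : 0 < p /\ p < 2.
  by move: p1; rewrite ltr_norml => /andP[? ?]; split; lra.
have d0 : 0 < kappa1 - kappa2.
  by move: b0; rewrite pmulr_rgt0// pmulr_rgt0.
have k1d : 3 * (p * (kappa1 - kappa2)) < 2 * kappa1.
  by rewrite -(ltr_pM2l tm); lra.
have kpd : 0 < kappa1 - p * (kappa1 - kappa2).
  have : 0 < p * (kappa1 - kappa2) by rewrite mulr_gt0.
  lra.
split=> //.
  by rewrite d0 /= ltr_pdivlMr ?mulr_gt0//; lra.
(* Up to the factor tau mu, this is the third Jury inequality [hH], where a - b is tau mu (kappa1 -
   p (kappa1 - kappa2)). *)
rewrite ltr_pdivlMr ?mulr_gt0 ?exprn_gt0// -(ltr_pM2l tm).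
by move: hH; nra.
Unshelve. all: by end_near. Qed.

Lemma conditions_sync :
  `|1 - p| < 1 -> 0 < kappa1 - kappa2 < (2 * kappa1) / (3 * p) ->
  tau < (p * (kappa2 - p * (kappa1 - kappa2))) /
        (mu * (kappa1 - p * (kappa1 - kappa2)) ^+ 2) ->
  achieves_synchronization A t0 tau.
Proof.
move=> p1 /andP[d0 dk] tauB z0.
have [pp0 pp2] : 0 < p /\ p < 2.
  by move: p1; rewrite ltr_norml => /andP[? ?]; split; lra.
have k1d : 3 * (p * (kappa1 - kappa2)) < 2 * kappa1.
  by move: dk; rewrite ltr_pdivlMr ?mulr_gt0//; lra.
have pd : 0 < p * (kappa1 - kappa2) by rewrite mulr_gt0.
have kpd : 0 < kappa1 - p * (kappa1 - kappa2) by lra.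
move: tauB; rewrite ltr_pdivlMr ?mulr_gt0 ?exprn_gt0// => tauB.
have Hev nu : eigenvalue (complex_mx (L *m diag_mx r)) nu ->
    exists2 nu' : R, nu = nu'%:C & 0 <= nu' <= mu.
  move=> ne; have := mu_largest.2 _ ne; rewrite lecE /= => /andP[/eqP zi zr].
  have zE : nu = (complex.Re nu)%:C.
    by apply/eqP; rewrite eq_complex -zi !eqxx.
  exists (complex.Re nu) => //; rewrite zr andbT.
  apply: (@laplacian_eigenvalue_ge0 _ _ E alpha r) => //.
  by rewrite -eigenvalue_complex_mx -zE.
have Aev : forall z, eigenvalue (complex_mx A) z -> z = 1 \/ normc z < 1.
  apply: (system_eigenvalue tau_gt0 Hev p1) => nu /andP[nu0 num].
  have e0 : 0 < tau * nu by rewrite mulr_gt0.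
  have em : tau * nu <= tau * mu by rewrite ler_pM2l.
  apply: cubic_schur_stable.
  - by rewrite pp0.
  - by rewrite mulr_gt0.
  - by move: k1d; rewrite -(ltr_pM2l e0); lra.
  - have D0 : 0 < (kappa1 - p * (kappa1 - kappa2)) ^+ 2 by rewrite exprn_gt0.
    (* The left side grows with nu, so the bound at [mu] covers every smaller positive
       eigenvalue. *)
    have : tau * nu * (kappa1 - p * (kappa1 - kappa2)) ^+ 2 <
           p * (kappa2 - p * (kappa1 - kappa2)).
      apply: le_lt_trans tauB; rewrite [leRHS]mulrA ler_pM2r//.
    by rewrite -(ltr_pM2l e0); lra.
have [w [[k wk] Hw]] := iter_unipotent_split Aev z0.
have [||c [d cd]] := unipotent_clocks (ltnW n_gt1) E_irr E_conn alpha_gt0 r_gt0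
  tau_gt0 _ _ wk.
- by rewrite gt_eqF.
- by rewrite -subr_eq0 gt_eqF.
(* The gain [d] is per step and a step lasts [tau]. *)
exists (d / tau), c => i; have := Hw (lshift _ i).
move=> lim; apply: eq_fun_cvg lim => j; congr (_ - _); first by rewrite /clocks mxE.
have := cd j i; rewrite /clocks mxE => ->; rewrite /sample_time.
by field; rewrite gt_eqF.
Qed.

End Synchronization.

Theorem theorem2 (R : realType) (n : nat) (hn : (2 <= n)%N)
    (E : rel 'I_n) (hE : irreflexive E) (hconn : connected_digraph E)
    (alpha : 'I_n -> 'I_n -> R)
    (halpha : forall i j : 'I_n, E i j -> 0 < alpha i j)
    (hL : has_real_eigenvalues (laplacian E alpha))
    (r : 'rV[R]_n) (hr : forall i : 'I_n, 0 < r 0 i)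
    (t0 tau : R) (htau : 0 < tau) (kappa1 kappa2 p mu_max : R)
    (hmu : is_largest_eigenvalue (laplacian E alpha *m diag_mx r) mu_max) :
  (`|1 - p| < 1 <-> 0 < p < 2) /\
  (achieves_synchronization
     (system_matrix (laplacian E alpha) r tau kappa1 kappa2 p) t0 tau <->
   [/\ `|1 - p| < 1,
       0 < kappa1 - kappa2 < (2 * kappa1) / (3 * p)
     & tau < (p * (kappa2 - p * (kappa1 - kappa2))) /
             (mu_max * (kappa1 - p * (kappa1 - kappa2)) ^+ 2)]).
Proof.
split.
  by rewrite ltr_norml; split=> /andP[? ?]; apply/andP; split; lra.
split; first exact: (sync_conditions hn hE hconn halpha hr htau hmu).
by case=> h1 h2 h3; exact: (conditions_sync t0 hn hE hconn halpha hr htau hmu).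
Qed.
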